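(* Let $G$ be a finite simple connected graph on $n\ge 3$ vertices. Then $M_G$ is a connected component of $Y_G$. Moreover, $M_G$ is preserved by the action of $\operatorname{Aut}(G)$.
   Context: A network realignment $N=(T,r)$ over $G$ consists of a partition $V(G)=A\sqcup B$ with $|A|\ge 2$ ($B$ may be empty), a tree $T$ that is a subgraph of $G$ with vertex set $A$, and a map $r\colon B\to E(T)$ such that $(b,v),(b,w)\in E(G)$ whenever $b\in B$ and $r(b)=(v,w)$. For $b\in B$ and an endpoint $v$ of $r(b)$, the specification $N^{b\to v}$ is the network realignment with partition $A\cup\{b\}$, $B\setminus\{b\}$, tree obtained from $T$ by adding the vertex $b$ and the edge $(v,b)$, and map $r|_{B\setminus\{b\}}$. $X_G$ is the finite cubical complex whose face poset is the set of all network realignments over $G$ with partial order generated by $N\succ N^{b\to v}$; the cell indexed by $N$ is a cube of dimension $|B|$. $\operatorname{Aut}(G)$ acts on $X_G$ by $gN=(gT,gr)$ with $(gr)(gb)=g(r(b))$. The spine $\operatorname{Sp}(N)$ is the subtree of $T$ consisting of the interior vertices $\operatorname{Int}(T)$ (vertices of degree $\ge2$ in $T$) and the edges in $\operatorname{Im}(r)$ (with their endpoints); $|\operatorname{Sp}(N)|$ is its number of edges. For a leaf $v$ of a tree $S$, $p_S(v)$ denotes its unique neighbour. A vertex $v$ is a barrier of $w$ if $(v,w)\notin E(G)$. A leaf $u$ of $\operatorname{Sp}(N)$ is occupied if there is a vertex $v\in V(T)\setminus V(\operatorname{Sp}(N))$ with $p_T(v)=u$ such that $p_{\operatorname{Sp}(N)}(u)$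 is a barrier of $v$. The spine is minimal if $|\operatorname{Sp}(N)|\le 1$ or all leaves of $\operatorname{Sp}(N)$ are occupied. $Y_G\subseteq X_G$ is the subcomplex of all $N$ with minimal spine (the minimal spine complex), and $M_G\subseteq Y_G$ is the set of all cells $N$ of $Y_G$ whose spine has at most one occupied vertex.
   Formalization: The claim is proved as ''M_G is empty or a connected component of Y_G'': M_G can be empty (for the path on four vertices the only realignment has two occupied vertices), and the empty set is not a connected component. *)

(* Defs.v *)
From HB Require Import structures.
From mathcomp Require Import all_boot all_order all_algebra fingroup perm.
From mathcomp Require Import all_classical all_reals all_analysis.
Set Implicit Arguments.
Unset Strict Implicit.
Unset Printing Implicit Defensive.
Import Order.TTheory GRing.Theory Num.Theory.
Import numFieldNormedType.Exports.
Local Open Scope nat_scope.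

(* A finite simple graph G is a symmetric irreflexive relation e on a finite
   type V; a subgraph is given by a vertex set and a set of edges, an edge
   being the unordered pair [set v; w]. *)

Section Trees.
Variable V : finType.
Implicit Types (A : {set V}) (S : {set {set V}}).

Definition adj S : rel V := [rel v w | [set v; w] \in S].

Definition nbhd S (v : V) : {set V} := [set w | adj S v w].

Definition leaf S (v : V) : bool := #|nbhd S v| == 1.

Definition is_tree A S : bool :=
  [&& A != finset.set0,
      [forall ed in S, (ed \subset A) && (#|ed| == 2)],
      [forall v in A, forall w in A, connect (adj S) v w]
    & `[< forall p : seq V, 2 < size p -> ~ ucycle (adj S) p >]].

Definition is_subgraph (e : rel V) S : bool :=
  [forall v, forall w, ([set v; w] \in S) ==> e v w].

End Trees.

(* The data (A, T, r) of a network realignment. Here B is the complement of A,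
   and r : B -> E(T) is a map to [option] with value None exactly on A. *)
Record net (V : finType) := Net {
  net_vertices : {set V};
  net_edges : {set {set V}};
  net_map : {ffun V -> option {set V}}
}.

Section NetFinite.
Variable V : finType.

Definition net_code (N : net V) :=
  (net_vertices N, net_edges N, net_map N).

Definition net_decode (c : {set V} * {set {set V}} * {ffun V -> option {set V}}) :=
  let: (A, T, r) := c in Net A T r.

Lemma net_codeK : cancel net_code net_decode.
Proof. by case. Qed.

HB.instance Definition _ := Finite.copy (net V) (can_type net_codeK).

End NetFinite.

Section Realignments.
Variables (V : finType) (e : rel V).
Implicit Types (N : net V) (b u v w : V).

Definition is_realignment N : bool :=
  [&& 2 <= #|net_vertices N|,
      is_tree (net_vertices N) (net_edges N),
      is_subgraph e (net_edges N),
      [forall b, (net_map N b == None) == (b \in net_vertices N)]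
    & [forall b, forall ed, (net_map N b == Some ed) ==>
         (ed \in net_edges N) && [forall v in ed, e b v]]].

Definition X_G : {set net V} := [set N | is_realignment N].

Definition specify N b v : net V :=
  Net (b |: net_vertices N)
      ([set v; b] |: net_edges N)
      [ffun x => if x == b then None else net_map N x].

Definition specifies : rel (net V) := [rel N N' |
  [exists b, exists ed, exists v,
    [&& net_map N b == Some ed, v \in ed & N' == specify N b v]]].

Definition face N' N : bool := connect specifies N N'.

Definition interior_vertices N : {set V} :=
  [set v in net_vertices N | 2 <= #|nbhd (net_edges N) v|].

Definition net_image N : {set {set V}} :=
  [set ed | [exists b, net_map N b == Some ed]].

Definition spine_vertices N : {set V} := interior_vertices N :|: finset.cover (net_image N).

(* A subtree of a tree contains every edge between two of its vertices. *)
Definition spine_edges N : {set {set V}} :=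
  [set ed in net_edges N | ed \subset spine_vertices N].

Definition barrier v w : bool := ~~ e v w.

(* For a leaf v of S, the unique neighbour p_S(v) is u iff nbhd S v = {u}. *)
Definition occupied N u : bool :=
  leaf (spine_edges N) u &&
  [exists v in net_vertices N :\: spine_vertices N, exists w,
    [&& nbhd (net_edges N) v == [set u],
        nbhd (spine_edges N) u == [set w]
      & barrier w v]].

Definition minimal_spine N : bool :=
  (#|spine_edges N| <= 1) ||
  [forall u, leaf (spine_edges N) u ==> occupied N u].

Definition Y_G : {set net V} := [set N in X_G | minimal_spine N].

(* M_G is empty exactly when no vertex of G is adjacent to all the others: in the
   path on four vertices the only realignment has two occupied vertices. *)
Definition M_G : {set net V} := [set N in Y_G | #|[set u | occupied N u]| <= 1].

Definition graph_aut : {set {perm V}} :=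
  [set g : {perm V} | [forall v, forall w, e (g v) (g w) == e v w]].

Definition net_act (g : {perm V}) N : net V :=
  Net (g @: net_vertices N)
      [set g @: (ed : {set V}) | ed in net_edges N]
      [ffun x => omap (fun ed : {set V} => g @: ed) (net_map N (g^-1%g x))].

End Realignments.

Section Space.
Variables (R : realType) (V : finType) (e : rel V).
Local Open Scope ring_scope.
Local Open Scope classical_set_scope.

(* A finite regular cell complex is the geometric realization of the order
   complex of its face poset (its barycentric subdivision), a point being given
   by its barycentric coordinates: a convex combination supported on a chain
   of cells. *)
Definition complex_space : set {ptws net V -> R} := [set x |
  [/\ forall N, 0 <= x N,
      \sum_(N : net V) x N = 1,
      forall N, x N != 0 -> N \in X_G e
    & forall N N', x N != 0 -> x N' != 0 -> face N N' || face N' N]].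

(* The relative interior of the cell N consists of the points whose supporting
   chain has N as its largest element. The union of these open cells for N in S
   is the subspace underlying the set of cells S. *)
Definition open_cell (N : net V) : set {ptws net V -> R} := [set x |
  [/\ complex_space x, x N != 0 & forall N', x N' != 0 -> face N' N]].

Definition cells_space (S : {set net V}) : set {ptws net V -> R} :=
  [set x | exists2 N, N \in S & open_cell N x].

End Space.

(* A connected component is nonempty. *)
Definition is_connected_component (T : topologicalType) (Y M : set T) : Prop :=
  exists2 x, Y x & M = connected_component Y x.

(* Main.v *)
Require Import Defs.
From mathcomp Require Import all_boot all_order all_algebra fingroup perm.
From mathcomp Require Import all_classical all_reals all_analysis.
Import numFieldNormedType.Exports.
Set Implicit Arguments.
Unset Strict Implicit.
Unset Printing Implicit Defensive.

(** Call a vertex w dominating if it is adjacent to all the others. The proof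
    rests on an explicit description of the cells of M_G: they are the
    realignments N for which some edge {u, w} of T with w dominating meets every
    edge of T and is the only value of r (M_GP). Indeed a spine with at least two
    edges is a forest, so it has two leaves, and minimality makes both occupied;
    hence a cell of M_G has at most one spine edge, and then T is a double star
    with centres u and w and r is constant with value {u, w}. If neither centre
    were dominating, a vertex not adjacent to w would not be in B nor hang on w, so
    it would hang on u; likewise some vertex would hang on w without being adjacent
    to u, and both u and w would be occupied. So one of the centres is dominating.
    Conversely a dominating centre w is never a barrier, so u is not
    occupied.

    Such a cell is determined by u, w and the sets L and K of leaves hanging on
    u and w (dstar). Three facts follow.
    - M_G is connected through faces: returning the leaves at u to B and then
      moving all of B to w joins every cell to the spanning star centred at w, and
      the cell with T reduced to the edge {w, w'} has the stars at w and at w'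
      among its faces when both are dominating (M_G_linked).
    - M_G is closed under passing to a face or a coface inside Y_G. A face of a
      double star is a double star with the same centres. If a cell N' of Y_G has
      two occupied vertices, these are still interior vertices of T in each face
      N; if N were in M_G they would be its two centres a and b, with a dominating,
      say. The spine neighbour c of b is a barrier, so c is not a; as T has no other
      interior vertices, c is a leaf both of T and of the spine of N'. But a leaf
      of T is never occupied, and the spine has two edges, which contradicts
      minimality (M_G_face_up).
    - An automorphism of G sends double stars to double stars and dominating
      vertices to dominating vertices (M_G_aut).

    For the topology, a union of open cells closed under faces and cofaces inside
    Y_G is open and closed in it, because being above some cell of a given set is
    an open condition on barycentric coordinates. It is connected as soon as its
    cells are linked by faces, by straight segments towards barycentres
    (linked_cells_component). *)

(** * Forests *)

Section Forests.
Local Open Scope set_scope.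
Variable V : finType.
Implicit Types (S : {set {set V}}) (x y z : V) (s : seq V).

Lemma adjC S : symmetric (adj S).
Proof. by move=> x y; rewrite /adj /= finset.setUC. Qed.

Lemma eq_set2 (a b c d : V) : [set a; b] = [set c; d] ->
  (a = c /\ b = d) \/ (a = d /\ b = c).
Proof.
move=> eq_ab.
have mem x : (x == a) || (x == b) = (x == c) || (x == d).
  by move/setP/(_ x): eq_ab; rewrite !finset.inE.
have := mem a; have := mem b; have := mem c; have := mem d.
rewrite !eqxx !orbT /=.
case: (eqVneq a c) => ac; case: (eqVneq a d) => ad;
  case: (eqVneq b c) => bc; case: (eqVneq b d) => bd //= *; subst; by [left | right].
Qed.

Definition acyclic S := forall p, 2 < size p -> ~ ucycle (adj S) p.

Lemma acyclic_sub S S' : S \subset S' -> acyclic S' -> acyclic S.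
Proof.
move=> sub acS' p p_gt2 /andP[cyc_p uniq_p]; apply: (acS' p p_gt2).
apply/andP; split=> //; apply: sub_cycle cyc_p => x y.
by rewrite /adj /=; apply: (fintype.subsetP sub).
Qed.

(** The predecessor and the successor on the cycle, which differ because the
    cycle has more than two vertices. *)
Lemma cycle_two_neighbours S p x : 2 < size p -> ucycle (adj S) p -> x \in p ->
  exists y z, [/\ y != z, adj S x y & adj S x z].
Proof.
move=> p_gt2 /andP[cyc_p uniq_p] x_p; have [i q rot_p] := rot_to x_p.
move: cyc_p uniq_p p_gt2; rewrite -(rot_cycle i) -(rot_uniq i) -(size_rot i p).
rewrite rot_p; case: q rot_p => [|y [|z q]] //= rot_p.
move=> /and3P[adj_xy _ path_q] /and3P[_ y_notin _] _.
exists y, (last z q); split => //.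
  by apply: contraNneq y_notin => ->; rewrite mem_last.
by move: path_q; rewrite rcons_path adjC => /andP[].
Qed.

Lemma no_triangle S x y z : acyclic S -> uniq [:: x; y; z] ->
  adj S x y -> adj S y z -> adj S z x -> False.
Proof.
move=> acS uniq_xyz xy yz zx; apply: (acS [:: x; y; z]) => //.
by rewrite /ucycle /cycle /= xy yz zx.
Qed.

(** A second neighbour of the head would lengthen the path if it were off the
    path, and would close a cycle if it were on it. *)
Lemma maximal_path_head_leaf S s x0 : acyclic S -> irreflexive (adj S) ->
    uniq s -> sorted (adj S) s -> 1 < size s ->
    (forall t, uniq t -> sorted (adj S) t -> size t <= size s) ->
  leaf S (head x0 s).
Proof.
case: s => [|x [|y p]] // acS irrS uniq_s sort_s _ max_s /=.
apply/cards1P; exists y.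
have /andP[adj_xy path_p] : adj S x y && path (adj S) y p by [].
apply/setP => z; rewrite !finset.inE; apply/idP/eqP => [adj_xz | -> //].
have [z_s|z_notin] := boolP (z \in [:: x, y & p]); last first.
  have := max_s [:: z, x, y & p]; rewrite cons_uniq z_notin uniq_s /= adjC.
  by rewrite adj_xz adj_xy path_p ltnn => /(_ isT isT).
apply/eqP/negPn/negP => z_neq_y.
have z_p : z \in p.
  move: z_s; rewrite !finset.inE (negPf z_neq_y) /=; case/orP => // /eqP eq_zx.
  by move: adj_xz; rewrite eq_zx irrS.
case/splitPr: z_p path_p uniq_s => p1 p2 path_p uniq_s.
apply: (acS [:: x, y & rcons p1 z]); first by rewrite /= size_rcons.
apply/andP; split.
  rewrite /cycle /= adj_xy rcons_path last_rcons adjC adj_xz andbT.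
  by move: path_p; rewrite -cat_rcons cat_path => /andP[].
by move: uniq_s; rewrite -cat_rcons -!cat_cons cat_uniq => /andP[].
Qed.

(** The two ends of a longest path. *)
Lemma forest_two_leaves S x y : acyclic S -> irreflexive (adj S) -> adj S x y ->
  exists a b, [/\ a != b, leaf S a & leaf S b].
Proof.
move=> acS irrS adj_xy.
pose P n := [exists t : n.-tuple V, uniq t && sorted (adj S) t].
have exP s : uniq s -> sorted (adj S) s -> P (size s).
  by move=> us ss; apply/existsP; exists (in_tuple s); rewrite /= us ss.
have P2 : P 2.
  apply: (exP [:: x; y]); rewrite /= ?andbT ?adj_xy // inE.
  by apply: contraTneq adj_xy => ->; rewrite irrS.
have boundP n : P n -> n <= #|V|.
  case/existsP => t /andP[ut _]; rewrite -(size_tuple t) -(card_uniqP ut).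
  exact: max_card.
have [n /existsP[t /andP[ut st]] max_n] := ex_maxnP (ex_intro P _ P2) boundP.
have n_gt1 : 1 < size t by rewrite size_tuple max_n.
have max_t s : uniq s -> sorted (adj S) s -> size s <= size t.
  by move=> us ss; rewrite size_tuple max_n // exP.
exists (head x t), (head x (rev t)); split.
- case: (tval t) ut n_gt1 => [|a [|b s]] //= /andP[a_notin _] _.
  rewrite lastI rev_rcons /=; apply: contraNneq a_notin => ->.
  exact: mem_last.
- exact: maximal_path_head_leaf.
- apply: maximal_path_head_leaf => //; rewrite ?rev_uniq ?size_rev //.
  by rewrite rev_sorted (eq_sorted (e' := adj S)) // => a b; rewrite adjC.
Qed.

End Forests.

(** * Realignments, their spines and double stars *)

Section Realignments.
Local Open Scope set_scope.
Variables (V : finType) (e : rel V).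
Hypothesis e_irr : irreflexive e.
Implicit Types (N : net V) (u v w x y b : V) (L K : {set V}).

(** Membership in the complex phrased with adjacency in T, the form in which the
    combinatorial arguments use it. *)
Record realignment_spec N : Prop := RealignmentSpec {
  two_vertices : 2 <= #|net_vertices N|;
  tree_edge_vertex : forall x y, adj (net_edges N) x y -> x \in net_vertices N;
  tree_edge_card : forall ed, ed \in net_edges N -> #|ed| = 2;
  tree_connected : forall x y, x \in net_vertices N -> y \in net_vertices N ->
    connect (adj (net_edges N)) x y;
  tree_acyclic : acyclic (net_edges N);
  tree_subgraph : forall x y, adj (net_edges N) x y -> e x y;
  net_map_None : forall b, (net_map N b == None) = (b \in net_vertices N);
  net_map_edge : forall b ed, net_map N b = Some ed -> ed \in net_edges N;
  net_map_adj : forall b ed v, net_map N b = Some ed -> v \in ed -> e b v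
}.

Lemma realignmentP N : N \in X_G e -> realignment_spec N.
Proof.
rewrite finset.inE => /and5P[two_A /and4P[_ edges_A conn_A acy_A] sub_T map_A map_e].
have edgeP ed : ed \in net_edges N -> (ed \subset net_vertices N) /\ #|ed| = 2.
  by move=> edN; have /forall_inP/(_ _ edN)/andP[? /eqP] := edges_A.
have mapP b ed : net_map N b = Some ed ->
    ed \in net_edges N /\ forall v, v \in ed -> e b v.
  move=> /eqP mapN; have /forallP/(_ b)/forallP/(_ ed) := map_e.
  by rewrite mapN => /andP[? /forall_inP].
split=> //.
- by move=> x y /edgeP[/fintype.subsetP sub_A _]; rewrite sub_A ?set21.
- by move=> ed /edgeP[].
- by move=> x y xA yA; have /forall_inP/(_ x xA)/forall_inP/(_ y yA) := conn_A.
- by have /asboolP := acy_A.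
- by move=> x y adj_xy; have /forallP/(_ x)/forallP/(_ y)/implyP := sub_T; apply.
- by move=> b; have /forallP/(_ b)/eqP := map_A.
- by move=> b ed /mapP[].
- by move=> b ed v /mapP[_]; apply.
Qed.

Lemma tree_irreflexive N : realignment_spec N -> irreflexive (adj (net_edges N)).
Proof.
by move=> realN x; apply/negP => /(tree_subgraph realN); rewrite e_irr.
Qed.

Lemma tree_edge_vertex2 N x y :
  realignment_spec N -> adj (net_edges N) x y -> y \in net_vertices N.
Proof. by move=> realN; rewrite adjC; apply: tree_edge_vertex. Qed.

Lemma interior_two_neighbours N x y z : realignment_spec N ->
  adj (net_edges N) x y -> adj (net_edges N) x z -> y != z ->
  x \in interior_vertices N.
Proof.
move=> realN xy xz y_neq_z; rewrite finset.inE (tree_edge_vertex realN xy) /=.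
apply: leq_trans (_ : #|[set y; z]| <= _); first by rewrite cards2 y_neq_z.
by apply/subset_leq_card/fintype.subsetP => t; rewrite !finset.inE => /orP[] /eqP->.
Qed.

Lemma interiorP N x : x \in interior_vertices N -> exists y z,
  [/\ y != z, adj (net_edges N) x y & adj (net_edges N) x z].
Proof.
rewrite finset.inE => /andP[_ /card_gt1P[y [z [y_nbr z_nbr y_neq_z]]]].
by exists y, z; split=> //; [move: y_nbr|move: z_nbr]; rewrite finset.inE.
Qed.

Lemma spine_edgesE N x y : adj (spine_edges N) x y =
  [&& adj (net_edges N) x y, x \in spine_vertices N & y \in spine_vertices N].
Proof.
rewrite /adj /= finset.inE; congr (_ && _).
by rewrite finset.subUset !finset.sub1set.
Qed.

Lemma interior_spine N x : x \in interior_vertices N -> x \in spine_vertices N.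
Proof. by move=> xI; rewrite finset.in_setU xI. Qed.

Lemma image_spine_edge N b ed : realignment_spec N ->
  net_map N b = Some ed -> ed \in spine_edges N.
Proof.
move=> realN mapN; rewrite finset.inE (net_map_edge realN mapN) /=.
apply/fintype.subsetP => x x_ed; rewrite finset.in_setU; apply/orP; right.
apply/bigcupP; exists ed => //; rewrite finset.inE.
by apply/existsP; exists b; apply/eqP.
Qed.

Definition dominating w := [forall x, (x != w) ==> e w x].

Lemma dominatingP w : reflect (forall x, x != w -> e w x) (dominating w).
Proof. exact: 'forall_implyP. Qed.

(** T is a double star with centres u and w. The spine may be smaller than
    {u, w}: in a star centred at w, any leaf can serve as u. *)
Record bicentered N u w : Prop := Bicentered {
  central_edge : adj (net_edges N) u w;
  edge_meets_centre : forall x y, adj (net_edges N) x y ->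
    [|| x == u, x == w, y == u | y == w];
  map_central : forall b ed, net_map N b = Some ed -> ed = [set u; w]
}.

Lemma bicenteredC N u w : bicentered N u w -> bicentered N w u.
Proof.
case=> uw meet mapN; split; first by rewrite adjC.
  by move=> x y /meet; case: (x == u); case: (x == w); case: (y == u); case: (y == w).
by move=> b ed /mapN ->; rewrite finset.setUC.
Qed.

Lemma exists_tree_edge N : realignment_spec N -> exists x y, adj (net_edges N) x y.
Proof.
move=> realN; have /card_gt1P[x [y [xA yA x_neq_y]]] := two_vertices realN.
have /connectP[[|z p] /= path_p last_p] := tree_connected realN xA yA.
  by rewrite last_p eqxx in x_neq_y.
by exists x, z; have /andP[] := path_p.
Qed.

(** The centres are the ends of the spine edge, or of any edge of T if there is
    none. A neighbour x of u other than w has no neighbour besides u, as otherwise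
    x and u are both interior and {u, x} is another spine edge; so the vertices at
    distance at most one from {u, w} are closed under adjacency and exhaust T. *)
Lemma small_spine_bicentered N : N \in X_G e -> #|spine_edges N| <= 1 ->
  exists u w, bicentered N u w.
Proof.
move=> /realignmentP realN small.
have [u [w [uw spine_uw]]] : exists u w, adj (net_edges N) u w /\
    forall ed, ed \in spine_edges N -> ed = [set u; w].
  have [spine0|[ed spine_ed]] := set_0Vmem (spine_edges N).
    have [u [w uw]] := exists_tree_edge realN; exists u, w; split=> // ed.
    by rewrite spine0 finset.inE.
  have edN : ed \in net_edges N by move: spine_ed; rewrite finset.inE => /andP[].
  have /cards2P[u [w [_ ed_uw]]] : #|ed| == 2 by rewrite (tree_edge_card realN).
  exists u, w; split=> [|ed' spine_ed']; first by rewrite /adj /= -ed_uw.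
  rewrite -ed_uw; have /card_le1_eqP := small; exact.
(* Values of r are spine edges, so only the condition on edges remains. *)
exists u, w; split=> //; last first.
  by move=> b ed /(image_spine_edge realN)/spine_uw.
(* Stated for both orders of the centres, so that it serves twice. *)
have pendant x y u' w' : (u', w') \in [:: (u, w); (w, u)] ->
    adj (net_edges N) u' x -> x != w' -> adj (net_edges N) x y -> y = u'.
  move=> uw' u'x x_neq xy; apply/eqP; apply: contraT => y_neq.
  have u'w' : adj (net_edges N) u' w'.
    by move: uw'; rewrite !inE => /orP[] /eqP[-> ->]; rewrite // adjC.
  have : adj (spine_edges N) u' x.
    rewrite spine_edgesE u'x !interior_spine //.
      by apply: (interior_two_neighbours realN xy _ y_neq); rewrite adjC.
    exact: (interior_two_neighbours realN u'x u'w' x_neq).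
  move=> /spine_uw eq_edge; have : x \in [set u; w] by rewrite -eq_edge set22.
  have : u' != x by apply: contraTneq u'x => ->; rewrite tree_irreflexive.
  move: uw' x_neq; rewrite !inE; case/orP => /eqP[-> ->] /negPf-> ;
    by rewrite ?orbF /= eq_sym => /negPf->.
pose C := [set x | [|| x == u, x == w, adj (net_edges N) u x | adj (net_edges N) w x]].
have closedC : fingraph.closed (adj (net_edges N)) (mem C).
  apply: intro_closed => [|x y xy]; first exact/sym_connect_sym/adjC.
  rewrite !finset.inE => /or4P[/eqP x_u|/eqP x_w|ux|wx].
  - by rewrite -x_u xy !orbT.
  - by rewrite -x_w xy !orbT.
  - have [x_w|x_neq] := eqVneq x w; first by rewrite -x_w xy !orbT.
    by rewrite (pendant x y u w) ?eqxx // inE eqxx.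
  - have [x_u|x_neq] := eqVneq x u; first by rewrite -x_u xy !orbT.
    by rewrite (pendant x y w u) ?eqxx ?orbT // !inE eqxx orbT.
move=> x y xy.
have : x \in C.
  rewrite -(closed_connect closedC (_ : connect (adj (net_edges N)) u x)).
    by rewrite finset.inE eqxx.
  by apply: (tree_connected realN);
    [exact: tree_edge_vertex uw | exact: tree_edge_vertex xy].
have [//|x_u] := eqVneq x u; have [//|x_w] := eqVneq x w.
rewrite finset.inE (negPf x_u) (negPf x_w) /= => /orP[ux|wx].
  by rewrite (pendant x y u w) ?eqxx // inE eqxx.
by rewrite (pendant x y w u) ?eqxx ?orbT // !inE eqxx orbT.
Qed.

End Realignments.

(** * The cells with at most one occupied vertex *)

Section Characterization.
Local Open Scope set_scope.
Variables (V : finType) (e : rel V).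
Hypotheses (e_sym : symmetric e) (e_irr : irreflexive e).
Implicit Types (N : net V) (u v w x y b : V) (L K : {set V}).

(** Any other vertex with two neighbours is adjacent to both centres, which
    gives a triangle in T. *)
Lemma bicentered_interior N u w x : realignment_spec e N -> bicentered N u w ->
  x \in interior_vertices N -> x \in [set u; w].
Proof.
move=> realN [uw meet _] /interiorP[y [z [y_neq_z xy xz]]].
rewrite !inE; apply: contraT; rewrite negb_or => /andP[x_u x_w].
have u_neq_w : u != w by apply: contraTneq uw => ->; rewrite (tree_irreflexive e_irr realN).
have := meet _ _ xy; have := meet _ _ xz; rewrite (negPf x_u) (negPf x_w) /=.
have adj_ux t : adj (net_edges N) x t -> adj (net_edges N) t x by rewrite adjC.
case/orP => /eqP z_eq /orP[] /eqP y_eq; subst y z; rewrite ?eqxx // in y_neq_z.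
  by case: (no_triangle (tree_acyclic realN) _ xz uw (adj_ux _ xy));
    rewrite /= !inE negb_or x_u x_w u_neq_w.
by case: (no_triangle (tree_acyclic realN) _ xy uw (adj_ux _ xz));
  rewrite /= !inE negb_or x_u x_w u_neq_w.
Qed.

Lemma bicentered_spine_vertex N u w x : realignment_spec e N -> bicentered N u w ->
  x \in spine_vertices N -> x \in [set u; w].
Proof.
move=> realN biN; rewrite {1}/spine_vertices finset.in_setU => /orP[|/finset.bigcupP[ed]].
  exact: bicentered_interior.
by rewrite finset.inE => /existsP[b /eqP/(map_central biN) ->].
Qed.

Lemma bicentered_spine_edge N u w ed : realignment_spec e N -> bicentered N u w ->
  ed \in spine_edges N -> ed = [set u; w].
Proof.
move=> realN biN; rewrite finset.inE => /andP[edN /fintype.subsetP ed_spine].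
apply/eqP; rewrite eqEcard (tree_edge_card realN edN) cards2 ltnS leq_b1 andbT.
by apply/fintype.subsetP => x /ed_spine; apply: bicentered_spine_vertex.
Qed.

(** A vertex v not adjacent to w in G is not mapped to {u, w} by r, hence is in
    T, and it can only hang on u. *)
Lemma nondominating_pendant N u w : realignment_spec e N -> bicentered N u w ->
  ~~ dominating e w ->
  exists v, [/\ nbhd (net_edges N) v = [set u], ~~ e w v & v \notin [set u; w]].
Proof.
move=> realN biN; rewrite negb_forall => /existsP[v]; rewrite negb_imply => /andP[v_w not_wv].
have uw := central_edge biN; have e_uw := tree_subgraph realN uw.
have v_u : v != u by apply: contraNneq not_wv => ->; rewrite e_sym.
have vA : v \in net_vertices N.
  rewrite -(net_map_None realN); apply: contraT; case mapv: (net_map N v) => [ed|//] _.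
  have ed_uw := map_central biN mapv; have := net_map_adj realN mapv (_ : w \in ed).
  by rewrite ed_uw set22 e_sym (negPf not_wv) => /(_ isT).
have only_u y : adj (net_edges N) v y -> y = u.
  move=> vy; have := edge_meets_centre biN vy; rewrite (negPf v_u) (negPf v_w) /=.
  case/orP => /eqP // y_w; have := tree_subgraph realN vy.
  by rewrite y_w e_sym (negPf not_wv).
have /connectP[[|y p] /= path_p last_p] :=
  tree_connected realN vA (tree_edge_vertex realN uw).
  by rewrite last_p eqxx in v_u.
have /andP[vy _] := path_p.
exists v; split=> //; last by rewrite !inE negb_or v_u v_w.
apply/setP => z; rewrite !finset.inE; apply/idP/eqP => [/only_u//|->].
by rewrite -(only_u _ vy).
Qed.

Lemma pendant_adj N u v : nbhd (net_edges N) v = [set u] -> adj (net_edges N) u v.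
Proof. by rewrite adjC => nbv; have := set11 u; rewrite -nbv finset.inE. Qed.

Lemma pendant_vertex_interior N u w v : realignment_spec e N -> bicentered N u w ->
  nbhd (net_edges N) v = [set u] -> v \notin [set u; w] -> u \in interior_vertices N.
Proof.
move=> realN biN /pendant_adj uv.
rewrite finset.in_set2 negb_or => /andP[_ v_w].
exact: (interior_two_neighbours realN uv (central_edge biN) v_w).
Qed.

(** The hypothesis on w ensures that {u, w} is a spine edge, so that u is a leaf
    of the spine at all. *)
Lemma pendant_occupied N u w v : realignment_spec e N -> bicentered N u w ->
  w \in spine_vertices N -> nbhd (net_edges N) v = [set u] -> ~~ e w v ->
  v \notin [set u; w] -> occupied e N u.
Proof.
move=> realN biN w_spine nbv not_wv v_uw.
have uw := central_edge biN.
have u_spine := interior_spine (pendant_vertex_interior realN biN nbv v_uw).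
have nbu : nbhd (spine_edges N) u = [set w].
  apply/setP => y; rewrite !finset.inE; apply/idP/eqP => [uy|->]; last first.
    by rewrite spine_edgesE uw u_spine w_spine.
  have /eq_set2[[]//|[u_w y_u]] := bicentered_spine_edge realN biN uy.
  by rewrite y_u.
apply/andP; split; first by rewrite /leaf nbu cards1.
apply/exists_inP; exists v.
  rewrite finset.in_setD (tree_edge_vertex2 realN (pendant_adj nbv)) andbT.
  by apply: contra v_uw; apply: bicentered_spine_vertex.
by apply/existsP; exists w; rewrite nbv nbu !eqxx.
Qed.

Lemma occupiedP N u : occupied e N u -> exists v w,
  [/\ nbhd (net_edges N) v = [set u], v \notin spine_vertices N,
      nbhd (spine_edges N) u = [set w] & ~~ e w v].
Proof.
case/andP => _ /exists_inP[v]; rewrite finset.in_setD => /andP[v_spine _].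
by case/existsP => w /and3P[/eqP nbv /eqP nbu not_wv]; exists v, w.
Qed.

(** The spine is a forest with an edge, so it has two leaves, and minimality
    makes all leaves of a spine with two edges occupied. *)
Lemma large_spine_two_occupied N : realignment_spec e N -> minimal_spine e N ->
  1 < #|spine_edges N| -> 1 < #|[set u | occupied e N u]|.
Proof.
move=> realN; rewrite /minimal_spine leqNgt => minN large; move: minN.
rewrite large /= => /forallP leaf_occ.
have sub : spine_edges N \subset net_edges N.
  by apply/fintype.subsetP => ed; rewrite finset.inE => /andP[].
have acyc : acyclic (spine_edges N) := acyclic_sub sub (tree_acyclic realN).
have irr : irreflexive (adj (spine_edges N)).
  by move=> x; rewrite spine_edgesE (tree_irreflexive e_irr realN).
have [ed spine_ed] : exists ed, ed \in spine_edges N.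
  by apply/set0Pn; rewrite -card_gt0; apply: leq_trans large.
have /cards2P[x [y [_ ed_xy]]] : #|ed| == 2.
  by rewrite (tree_edge_card realN) //; apply: (fintype.subsetP sub).
have xy : adj (spine_edges N) x y by rewrite /adj /= -ed_xy.
have [a [b [a_b leaf_a leaf_b]]] := forest_two_leaves acyc irr xy.
apply/card_gt1P; exists a, b; split=> //; rewrite finset.inE.
  by have := leaf_occ a; rewrite leaf_a.
by have := leaf_occ b; rewrite leaf_b.
Qed.

(** The combinatorial description of M_G on which everything else relies. *)
Lemma M_GP N : reflect
  (N \in X_G e /\ exists u w, bicentered N u w /\ dominating e w) (N \in M_G e).
Proof.
apply: (iffP idP) => [|[NX [u [w [biN dom_w]]]]].
  rewrite /M_G /Y_G finset.inE => /andP[]; rewrite finset.inE => /andP[NX minN] occ_le1.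
  split=> //; have realN := realignmentP NX.
  have small : #|spine_edges N| <= 1.
    rewrite leqNgt; apply/negP => /(large_spine_two_occupied realN minN).
    by rewrite ltnNge occ_le1.
  have [u [w biN]] := small_spine_bicentered e_irr NX small.
  have [dom_w|not_dom_w] := boolP (dominating e w); first by exists u, w.
  have [dom_u|not_dom_u] := boolP (dominating e u).
    by exists w, u; split=> //; apply: bicenteredC.
  (* If neither centre is dominating, each has a pendant vertex and is occupied. *)
  have biN' := bicenteredC biN.
  have [v [nbv wv v_uw]] := nondominating_pendant realN biN not_dom_w.
  have [v' [nbv' uv' v'_wu]] := nondominating_pendant realN biN' not_dom_u.
  have u_spine := interior_spine (pendant_vertex_interior realN biN nbv v_uw).
  have w_spine := interior_spine (pendant_vertex_interior realN biN' nbv' v'_wu).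
  have occ_u := pendant_occupied realN biN w_spine nbv wv v_uw.
  have occ_w := pendant_occupied realN biN' u_spine nbv' uv' v'_wu.
  have /card_le1_eqP/(_ u w) := occ_le1; rewrite !finset.inE => /(_ occ_u occ_w) u_w.
  by have := central_edge biN; rewrite u_w (tree_irreflexive e_irr realN).
(* Conversely, only w can be occupied: u has w as its neighbour in the spine. *)
have realN := realignmentP NX.
have spine_le1 : #|spine_edges N| <= 1.
  apply/card_le1_eqP => ed ed' /(bicentered_spine_edge realN biN)-> .
  by move=> /(bicentered_spine_edge realN biN)->.
rewrite finset.inE finset.inE NX /minimal_spine spine_le1 /=.
apply: leq_trans (_ : #|[set w]| <= 1); last by rewrite cards1.
apply/subset_leq_card/fintype.subsetP => x; rewrite !finset.inE.
case/occupiedP => v [y [nbv v_spine nbx not_yv]].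
have xy : adj (spine_edges N) x y by have := set11 y; rewrite -nbx finset.inE.
have := xy; rewrite spine_edgesE => /and3P[_ x_spine y_spine].
have /eq_set2[[x_u y_w]|[-> //]] := bicentered_spine_edge realN biN xy.
have v_w : v != w by apply: contraNneq v_spine => ->; rewrite -y_w.
by have /dominatingP/(_ v v_w) := dom_w; move: not_yv; rewrite y_w => /negPf->.
Qed.

End Characterization.

(** * Faces and cofaces *)

Section FaceClosure.
Local Open Scope set_scope.
Variables (V : finType) (e : rel V).
Hypotheses (e_sym : symmetric e) (e_irr : irreflexive e).
Implicit Types (N : net V) (u v w x y b : V) (L K : {set V}).

(** A specified vertex b gets attached to an end of r(b), which is a centre. *)
Lemma specifies_bicentered N N' u w :
  specifies N N' -> bicentered N u w -> bicentered N' u w.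
Proof.
case/existsP => b /existsP[ed /existsP[v /and3P[/eqP mapb v_ed /eqP ->]]].
case=> uw meet mapN; split; first by rewrite /adj /= finset.in_setU1; apply/orP; right.
  move=> x y; rewrite /adj /= finset.in_setU1 => /orP[/eqP|/meet//].
  move: v_ed; rewrite (mapN _ _ mapb) !inE => v_uw.
  by case/eq_set2 => -[-> ->]; case/orP: v_uw => ->; rewrite ?orbT.
by move=> b' ed'; rewrite /= ffunE; case: eqP => // _; apply: mapN.
Qed.

Lemma face_bicentered N N' u w :
  face N' N -> bicentered N u w -> bicentered N' u w.
Proof.
case/connectP => p; elim: p N => [|N1 p IHp] N /= => [_ -> //|].
case/andP => spec_N path_p last_p biN.
exact: IHp path_p last_p (specifies_bicentered spec_N biN).
Qed.

Lemma face_edges N N' : face N' N -> net_edges N \subset net_edges N'.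
Proof.
case/connectP => p; elim: p N => [|N1 p IHp] N /= => [_ -> //|].
case/andP => spec_N path_p last_p; apply: fintype.subset_trans (IHp _ path_p last_p).
case/existsP: spec_N => b /existsP[ed /existsP[v /and3P[_ _ /eqP ->]]].
exact: finset.subsetUr.
Qed.

(** Specification only adds edges to T. *)
Lemma face_interior N N' x : N' \in X_G e -> face N' N ->
  x \in interior_vertices N -> x \in interior_vertices N'.
Proof.
move=> /realignmentP realN' /face_edges/fintype.subsetP sub.
move=> /interiorP[y [z [y_neq_z xy xz]]].
exact: (interior_two_neighbours realN' (sub _ xy) (sub _ xz)).
Qed.

Lemma M_G_face_down N N' : N \in M_G e -> N' \in Y_G e -> face N' N -> N' \in M_G e.
Proof.
move=> /(M_GP e_sym e_irr)[_ [u [w [biN dom_w]]]] N'Y face_N'.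
apply/(M_GP e_sym e_irr); split; first by move: N'Y; rewrite finset.inE => /andP[].
by exists u, w; split=> //; apply: face_bicentered biN.
Qed.

(** Its neighbour outside the spine and its neighbour in the spine differ. *)
Lemma occupied_interior N u : realignment_spec e N -> occupied e N u ->
  u \in interior_vertices N.
Proof.
move=> realN /occupiedP[v [w [/pendant_adj uv v_spine nbu _]]].
have : adj (spine_edges N) u w by have := set11 w; rewrite -nbu finset.inE.
rewrite spine_edgesE => /and3P[uw _ w_spine].
apply: (interior_two_neighbours realN uv uw).
by apply: contraNneq v_spine => ->.
Qed.

(** Two occupied vertices a and b of N' would be the two centres of N, and one of
    them, say a, is dominating. The neighbour c of b in the spine of N' is then a
    leaf of T different from a, and the contradiction is that c should be occupied
    although it has no neighbour outside the spine. *)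
Lemma M_G_face_up N N' : N \in M_G e -> N' \in Y_G e -> face N N' -> N' \in M_G e.
Proof.
move=> /(M_GP e_sym e_irr)[NX [u [w [biN dom_w]]]] N'Y face_N.
rewrite finset.inE N'Y /= leqNgt; apply/negP => /card_gt1P[a [b [occ_a occ_b a_b]]].
move: occ_a occ_b; rewrite !finset.inE => occ_a occ_b.
have realN := realignmentP NX.
have /andP[N'X minN'] : (N' \in X_G e) && minimal_spine e N' by move: N'Y; rewrite finset.inE.
have realN' := realignmentP N'X.
(* By symmetry between a and b, the dominating centre is a. *)
wlog a_w : a b occ_a occ_b a_b / a = w.
  move=> wlog_a; have occ_centre c : occupied e N' c -> c \in [set u; w].
    move=> occ_c; apply: (bicentered_interior e_irr realN biN).
    exact: (face_interior NX face_N (occupied_interior realN' occ_c)).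
  have := occ_centre _ occ_a; have := occ_centre _ occ_b.
  rewrite !finset.in_set2 => /orP[/eqP b_u|/eqP b_w].
    case/orP => [/eqP a_u|/eqP a_w]; first by rewrite a_u b_u eqxx in a_b.
    exact: (wlog_a a b).
  by move=> _; apply: (wlog_a b a); rewrite // eq_sym.
have b_u : b = u.
  have := bicentered_interior e_irr realN biN
    (face_interior NX face_N (occupied_interior realN' occ_b)).
  by rewrite finset.in_set2 -a_w (eq_sym b a) (negPf a_b) orbF => /eqP.
have [v [c [nbv v_spine nbb not_cv]]] := occupiedP occ_b.
have bc : adj (spine_edges N') b c by have := set11 c; rewrite -nbb finset.inE.
have := bc; rewrite spine_edgesE => /and3P[tree_bc _ c_spine].
have c_w : c != w.
  apply: contraNneq not_cv => c_w; rewrite c_w; have /dominatingP := dom_w; apply.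
  by apply: contraNneq v_spine => ->; rewrite -c_w.
have c_b : c != b.
  by apply: contraTneq tree_bc => ->; rewrite (tree_irreflexive e_irr realN').
have only_b y : adj (net_edges N') c y -> y = b.
  move=> cy; apply/eqP; apply: contraT => y_b.
  have c_int : c \in interior_vertices N'.
    by apply: (interior_two_neighbours realN' cy _ y_b); rewrite adjC.
  have := bicentered_interior e_irr realN biN (face_interior NX face_N c_int).
  by rewrite finset.in_set2 -b_u (negPf c_b) (negPf c_w).
(* So c hangs on b in T, and is a leaf of the spine too. *)
have leaf_c : leaf (spine_edges N') c.
  apply/cards1P; exists b; apply/setP => y; rewrite !finset.inE.
  apply/idP/eqP => [|->]; last by rewrite adjC.
  by rewrite spine_edgesE => /andP[/only_b].
case/orP: minN' => [small|/forallP/(_ c)]; last first.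
  rewrite leaf_c /= => /occupiedP[v' [_ [/pendant_adj/only_b v'_b v'_spine _ _]]].
  case/negP: v'_spine; rewrite v'_b.
  by move: bc; rewrite spine_edgesE => /and3P[].
(* If the spine has only one edge, the spine edges at a and at b coincide, so c = a. *)
have [_ [d [_ _ nba _]]] := occupiedP occ_a.
have ad : adj (spine_edges N') a d by have := set11 d; rewrite -nba finset.inE.
have /card_le1_eqP/(_ _ _ ad bc)/eq_set2 := small.
by case=> [[b_a _]|[_ c_a]]; [rewrite b_a eqxx in a_b | rewrite c_a a_w eqxx in c_w].
Qed.

End FaceClosure.

(** * Double stars as explicit cells *)

Section DoubleStars.
Local Open Scope set_scope.
Variables (V : finType) (e : rel V).
Hypotheses (e_sym : symmetric e) (e_irr : irreflexive e).
Implicit Types (N : net V) (u v w x y b : V) (L K : {set V}) (ed : {set V}).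

Lemma net_ext N N' : net_vertices N = net_vertices N' ->
  net_edges N = net_edges N' -> net_map N = net_map N' -> N = N'.
Proof. by case: N N' => [A T r] [A' T' r'] /= -> -> ->. Qed.

(** The double star with leaves L on u and K on w, all remaining vertices being
    mapped to the central edge. *)
Definition dstar u w L K : net V :=
  Net ([set u; w] :|: (L :|: K))
      ([set u; w] |: ([set [set u; x] | x in L] :|: [set [set w; x] | x in K]))
      [ffun b => if b \in [set u; w] :|: (L :|: K) then None else Some [set u; w]].

Lemma dstarC u w L K : dstar u w L K = dstar w u K L.
Proof.
rewrite /dstar (finset.setUC [set u] [set w]) (finset.setUC L K).
by rewrite (finset.setUC [set [set u; x] | x in L]).
Qed.

Lemma dstar_edgeP u w L K ed : reflect
  [\/ ed = [set u; w], exists2 x, x \in L & ed = [set u; x]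
    | exists2 x, x \in K & ed = [set w; x]]
  (ed \in net_edges (dstar u w L K)).
Proof.
rewrite /= finset.in_setU1 finset.in_setU; apply: (iffP or3P).
  by case=> [/eqP|/imsetP|/imsetP] ?; [apply: Or31|apply: Or32|apply: Or33].
by case=> [/eqP|/imsetP|/imsetP] ?; [apply: Or31|apply: Or32|apply: Or33].
Qed.

(** The condition on u concerns the leaves on u and the vertices mapped to the
    central edge, besides w itself; the corresponding condition on w is part of w
    being dominating. *)
Record dstar_ok u w L K : Prop := DstarOk {
  centres_neq : u != w;
  left_leaf : forall x, x \in L -> (x \notin [set u; w]) && (x \notin K);
  right_leaf : forall x, x \in K -> x \notin [set u; w];
  left_centre_adj : forall x, x != u -> x \notin K -> e u x;
  right_centre_dominating : dominating e w
}.

Lemma dstar_bicentered u w L K : bicentered (dstar u w L K) u w.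
Proof.
split; first by apply/dstar_edgeP; apply: Or31.
  move=> x y /dstar_edgeP[/eq_set2[]|[z _ /eq_set2[]]|[z _ /eq_set2[]]] [-> ->];
    by rewrite eqxx ?orbT.
by move=> b ed; rewrite /= ffunE; case: ifP => // _ [<-].
Qed.

Lemma dstar_noncentral_neighbour u w L K x y : dstar_ok u w L K ->
  x \notin [set u; w] -> adj (net_edges (dstar u w L K)) x y ->
  (y = u /\ x \in L) \/ (y = w /\ x \in K).
Proof.
move=> ok x_uw; have := x_uw; rewrite !inE negb_or => /andP[x_u x_w].
case/dstar_edgeP => [/eq_set2[]|[z zL /eq_set2[]]|[z zK /eq_set2[]]] [xE yE];
  subst x y; rewrite ?eqxx // in x_u x_w *; by [left | right].
Qed.

(** A cycle has at least three vertices, so one of them is not a centre; its two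
    neighbours are then both centres, which puts it in L and in K. *)
Lemma dstar_acyclic u w L K :
  dstar_ok u w L K -> acyclic (net_edges (dstar u w L K)).
Proof.
move=> ok p p_gt2 cyc_p.
have [x x_p x_uw] : exists2 x, x \in p & x \notin [set u; w].
  apply/allPn; apply/negP => /allP p_sub.
  have /andP[_ uniq_p] := cyc_p.
  have sub : {subset p <= [:: u; w]} by move=> x /p_sub; rewrite !inE.
  by have := uniq_leq_size uniq_p sub; rewrite leqNgt p_gt2.
have [y [z [y_z xy xz]]] := cycle_two_neighbours p_gt2 cyc_p x_p.
have K_not_L : x \in L -> x \in K -> False.
  by move=> /(left_leaf ok)/andP[_ /negPf->].
have [[y_eq x1]|[y_eq x1]] := dstar_noncentral_neighbour ok x_uw xy;
have [[z_eq x2]|[z_eq x2]] := dstar_noncentral_neighbour ok x_uw xz;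
  try (by rewrite y_eq z_eq eqxx in y_z); exact: K_not_L.
Qed.

Lemma dstar_X u w L K : dstar_ok u w L K -> dstar u w L K \in X_G e.
Proof.
move=> ok; have u_w := centres_neq ok; have /dominatingP dom_w := right_centre_dominating ok.
have left_adj x : x \in L -> e u x.
  move=> /(left_leaf ok); rewrite !inE negb_or => /andP[/andP[x_u x_w] x_K].
  exact: (left_centre_adj ok).
have right_adj x : x \in K -> e w x.
  by move=> /(right_leaf ok); rewrite !inE negb_or => /andP[_]; apply: dom_w.
rewrite finset.inE; apply/and5P; split.
- apply: leq_trans (_ : #|[set u; w]| <= _); first by rewrite cards2 u_w.
  exact/subset_leq_card/finset.subsetUl.
- apply/and4P; split.
  + by apply/set0Pn; exists u; rewrite !inE eqxx.
  + apply/forall_inP => ed /dstar_edgeP[->|[x xL ->]|[x xK ->]].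
    * by rewrite finset.subsetUl cards2 u_w.
    * have /andP[] := left_leaf ok xL; rewrite finset.in_set2 negb_or => /andP[x_u _] _.
      by rewrite finset.subUset !finset.sub1set cards2 (eq_sym u) x_u !inE eqxx xL !orbT.
    * have := right_leaf ok xK; rewrite finset.in_set2 negb_or => /andP[_ x_w].
      by rewrite finset.subUset !finset.sub1set cards2 (eq_sym w) x_w !inE eqxx xK !orbT.
  + have conn_u x : x \in [set u; w] :|: (L :|: K) ->
        connect (adj (net_edges (dstar u w L K))) u x.
      have uw : adj (net_edges (dstar u w L K)) u w.
        exact: central_edge (dstar_bicentered _ _ _ _).
      rewrite !inE -orbA => /or4P[/eqP->|/eqP->|xL|xK]; first exact: connect0.
      * exact: connect1.
      * by apply: connect1; apply/dstar_edgeP; apply: Or32; exists x.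
      * apply: connect_trans (connect1 uw) (connect1 _).
        by apply/dstar_edgeP; apply: Or33; exists x.
    apply/forall_inP => x xA; apply/forall_inP => y yA.
    apply: connect_trans (conn_u y yA).
    by rewrite sym_connect_sym; [exact: conn_u | exact: adjC].
  + by apply/asboolP; exact: dstar_acyclic.
- apply/forallP => x; apply/forallP => y; apply/implyP.
  case/dstar_edgeP => [/eq_set2[]|[z /left_adj uz /eq_set2[]]|
                       [z /right_adj wz /eq_set2[]]] [-> ->] //;
    by rewrite // 1?e_sym // ?dom_w // e_sym dom_w.
- by apply/forallP => b; rewrite /= ffunE; case: ifP.
- apply/forallP => b; apply/forallP => ed; rewrite /= ffunE; case: ifP => // b_A.
  apply/implyP => /eqP[<-]; rewrite setU11 /=.
  move: b_A; rewrite !inE => /negbT; rewrite !negb_or => /andP[/andP[b_u b_w] /andP[_ b_K]].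
  apply/forall_inP => v; rewrite !inE => /orP[]/eqP->; rewrite e_sym.
    exact: (left_centre_adj ok).
  exact: dom_w.
Qed.

Lemma dstar_M u w L K : dstar_ok u w L K -> dstar u w L K \in M_G e.
Proof.
move=> ok; apply/(M_GP e_sym e_irr); split; first exact: dstar_X.
by exists u, w; split; [exact: dstar_bicentered | exact: right_centre_dominating ok].
Qed.

Lemma vertex_neighbour N x : realignment_spec e N -> x \in net_vertices N ->
  exists y, adj (net_edges N) x y.
Proof.
move=> realN xA; have [a [b ab]] := exists_tree_edge realN.
have [->|x_a] := eqVneq x a; first by exists b.
have /connectP[[|y p] /= path_p last_p] :=
  tree_connected realN xA (tree_edge_vertex realN ab).
  by rewrite last_p eqxx in x_a.
by exists y; have /andP[] := path_p.
Qed.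

(** L and K consist of the neighbours of u and of w in T other than the opposite
    centre; they are disjoint because T has no triangle. *)
Lemma bicentered_dstar N u w : N \in X_G e -> bicentered N u w ->
  dominating e w -> exists L K, N = dstar u w L K /\ dstar_ok u w L K.
Proof.
move=> NX biN dom_w; have realN := realignmentP NX.
have irrN := tree_irreflexive e_irr realN.
have uw := central_edge biN.
have u_w : u != w by apply: contraTneq uw => ->; rewrite irrN.
pose L := nbhd (net_edges N) u :\ w; pose K := nbhd (net_edges N) w :\ u.
have inL x : (x \in L) = (x != w) && adj (net_edges N) u x by rewrite !inE.
have inK x : (x \in K) = (x != u) && adj (net_edges N) w x by rewrite !inE.
have adj_neq x y : adj (net_edges N) x y -> y != x.
  by move=> xy; apply: contraTneq xy => ->; rewrite irrN.
have inA x : (x \in net_vertices N) = (x \in [set u; w] :|: (L :|: K)).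
  rewrite finset.in_setU finset.in_set2 finset.in_setU inL inK.
  have [->|x_u] := eqVneq x u; first by rewrite (tree_edge_vertex realN uw).
  have [->|x_w] /= := eqVneq x w; first by rewrite (tree_edge_vertex2 realN uw) ?orbT.
  apply/idP/orP => [xA|]; last by case=> /(tree_edge_vertex2 realN).
  have [y xy] := vertex_neighbour realN xA.
  have := edge_meets_centre biN xy; rewrite (negPf x_u) (negPf x_w) /=.
  by case/orP => /eqP y_eq; [left|right]; rewrite adjC -y_eq.
exists L, K; split.
  apply: net_ext; first exact/setP.
  - apply/setP => ed; apply/idP/(dstar_edgeP u w L K) => [edT|]; last first.
      case=> [->|[x]|[x]]; first exact: uw.
        by rewrite inL => /andP[_ ux] ->; exact: ux.
      by rewrite inK => /andP[_ wx] ->; exact: wx.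
    have /cards2P[x [y [x_y ed_xy]]] : #|ed| == 2 by rewrite (tree_edge_card realN).
    have {ed_xy edT} xy : adj (net_edges N) x y /\ ed = [set x; y] by rewrite /adj /= -ed_xy.
    have centred x' y' : adj (net_edges N) x' y' -> (x' == u) || (x' == w) ->
      [\/ [set x'; y'] = [set u; w], exists2 z, z \in L & [set x'; y'] = [set u; z]
        | exists2 z, z \in K & [set x'; y'] = [set w; z]].
      move=> xy' /orP[]/eqP x_eq; subst x'.
        have [->|y_w] := eqVneq y' w; [exact: Or31 | apply: Or32].
        by exists y'; rewrite // inL y_w.
      have [->|y_u] := eqVneq y' u; [by apply: Or31; rewrite finset.setUC | apply: Or33].
      by exists y'; rewrite // inK y_u.
    case: xy => xy ->; have := edge_meets_centre biN xy; rewrite orbA => /orP[|].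
      exact: centred.
    by rewrite (finset.setUC [set x]); apply: centred; rewrite adjC.
  - apply/ffunP => b; rewrite ffunE -inA -(net_map_None realN) /=.
    by case: eqP => // ; case mapb: (net_map N b) => [ed|//] _; rewrite (map_central biN mapb).
split=> //.
- move=> x; rewrite inL => /andP[x_w ux]; rewrite !inE negb_or x_w (adj_neq _ _ ux) /=.
  apply/negP => wx.
  apply: (no_triangle (tree_acyclic realN) _ uw wx); last by rewrite adjC.
  by rewrite /= !inE negb_or u_w eq_sym (adj_neq _ _ ux) eq_sym x_w.
- by move=> x; rewrite inK => /andP[x_u wx]; rewrite !inE negb_or x_u (adj_neq _ _ wx).
- move=> x x_u; rewrite inK x_u /= => not_wx.
  have [->|x_w] := eqVneq x w; first exact: tree_subgraph realN _ _ uw.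
  have [ux|not_ux] := boolP (adj (net_edges N) u x); first exact: tree_subgraph realN _ _ ux.
  have : x \notin net_vertices N.
    rewrite inA finset.in_setU finset.in_set2 finset.in_setU inL inK.
    rewrite (negPf not_ux) (negPf not_wx).
    by rewrite !andbF (negPf x_u) (negPf x_w).
  rewrite -(net_map_None realN); case mapx: (net_map N x) => [ed|//] _.
  rewrite e_sym; apply: (net_map_adj realN mapx).
  by rewrite (map_central biN mapx) set21.
Qed.

End DoubleStars.

(** * Zigzags of faces and automorphisms *)

Section Zigzags.
Local Open Scope set_scope.
Variables (V : finType) (e : rel V).
Hypotheses (e_sym : symmetric e) (e_irr : irreflexive e).
Implicit Types (N : net V) (u v w x y b : V) (L K : {set V}) (M : {set net V}).

Lemma dstar_specifies u w L K x : x \notin [set u; w] :|: (L :|: K) ->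
  specifies (dstar u w L K) (dstar u w (x |: L) K).
Proof.
move=> x_A; apply/existsP; exists x; apply/existsP; exists [set u; w].
apply/existsP; exists u; rewrite set21 /= ffunE (negPf x_A) eqxx /=; apply/eqP.
have eqA : [set u; w] :|: (x |: L :|: K) = x |: ([set u; w] :|: (L :|: K)).
  by rewrite -(finset.setUA [set x]) finset.setUCA.
apply: net_ext; first exact: eqA.
  by rewrite /= imsetU1 -(finset.setUA [set [set u; x]]) finset.setUCA.
apply/ffunP => b; rewrite !ffunE eqA finset.in_setU1.
by case: eqP => //= _; rewrite ffunE.
Qed.

(** The vertices of L' outside L are specified to u one at a time. *)
Lemma dstar_face_left u w L L' K : L \subset L' ->
    [disjoint L' & [set u; w] :|: K] ->
  face (dstar u w L' K) (dstar u w L K).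
Proof.
have [n] := ubnP #|L' :\: L|; elim: n L => // n IHn L le_n sub dis.
have [L'_eq|[x]] := set_0Vmem (L' :\: L).
  have -> : L' = L by apply/eqP; rewrite finset.eqEsubset sub -finset.setD_eq0 L'_eq eqxx.
  exact: connect0.
rewrite finset.in_setD => /andP[x_L x_L'].
have /negbT := disjointFr dis x_L'; rewrite finset.in_setU negb_or => /andP[x_uw x_K].
have x_A : x \notin [set u; w] :|: (L :|: K) 
  by rewrite finset.in_setU (negPf x_uw) finset.in_setU (negPf x_L) (negPf x_K).
apply: connect_trans (connect1 (dstar_specifies x_A)) (IHn _ _ _ dis).
  rewrite -ltnS; apply: leq_trans le_n; rewrite ltnS; apply: proper_card.
  rewrite finset.setUC -finset.setDDl; apply: properD1.
  by rewrite finset.in_setD x_L x_L'.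
by rewrite finset.subUset finset.sub1set x_L'.
Qed.

Lemma dstar_face_right u w L K K' : K \subset K' ->
    [disjoint K' & [set u; w] :|: L] ->
  face (dstar u w L K') (dstar u w L K).
Proof.
move=> sub dis; rewrite !(dstarC u); apply: dstar_face_left => //.
by rewrite finset.setUC in dis *; rewrite (finset.setUC [set w]) finset.setUC.
Qed.

Definition star w : net V :=
  Net [set: V] [set [set w; x] | x in [set~ w]] [ffun=> None].

(** The spanning star centred at w arises from w and any second centre, which is
    what allows the second centre to change. *)
Lemma dstar_full u w : u != w -> dstar u w finset.set0 (~: [set u; w]) = star w.
Proof.
move=> u_w; have full : [set u; w] :|: (finset.set0 :|: ~: [set u; w]) = [set: V].
  by rewrite finset.set0U finset.setUCr.
apply: net_ext => //.
  have others : [set~ w] = u |: ~: [set u; w].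
    by apply/setP => x; rewrite !inE negb_or; case: (eqVneq x u) => [->|].
  rewrite /star others.
  by rewrite /= imset0 finset.set0U imsetU1 (finset.setUC [set u] [set w]).
by apply/ffunP => b; rewrite !ffunE full finset.in_setT.
Qed.

Definition face_linked M : rel (net V) :=
  [rel N N' | [&& N \in M, N' \in M & face N N' || face N' N]].

Lemma face_linked_sym M : symmetric (face_linked M).
Proof. by move=> N N'; rewrite /face_linked /= andbCA orbC. Qed.

(** The intermediate cell returns all leaves on u to B; then every vertex of B can
    be specified to w. *)
Lemma linked_star N : N \in M_G e -> exists w,
  [/\ dominating e w, star w \in M_G e & connect (face_linked (M_G e)) N (star w)].
Proof.
move=> NM; have /(M_GP e_sym e_irr)[NX [u [w [biN dom_w]]]] := NM.
have [L [K [N_eq ok]]] := bicentered_dstar e_sym e_irr NX biN dom_w.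
have u_w := centres_neq ok.
have ok0 : dstar_ok e u w finset.set0 K.
  split=> //; first by move=> x; rewrite finset.inE.
    exact: right_leaf ok.
  exact: left_centre_adj ok.
have okC : dstar_ok e u w finset.set0 (~: [set u; w]).
  split=> //; [by move=> x; rewrite finset.inE | by move=> x; rewrite finset.in_setC |].
  move=> x x_u; rewrite finset.in_setC negbK finset.in_set2 (negPf x_u) /= => /eqP->.
  by rewrite e_sym; have /dominatingP := dom_w; apply.
exists w; rewrite -(dstar_full u_w).
split=> //; first exact: dstar_M okC.
pose mid := dstar u w finset.set0 K.
have mid_M : mid \in M_G e := dstar_M e_sym e_irr ok0.
have face_N : face N mid.
  rewrite N_eq; apply: dstar_face_left; first exact: finset.sub0set.
  rewrite disjoint_subset; apply/fintype.subsetP => x /(left_leaf ok)/andP[x_uw x_K].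
  by rewrite inE finset.in_setU negb_or x_uw.
have face_star : face (dstar u w finset.set0 (~: [set u; w])) mid.
  apply: dstar_face_right.
    by apply/fintype.subsetP => x /(right_leaf ok); rewrite finset.in_setC.
  by rewrite finset.setU0 disjoint_sym -finset.setI_eq0 finset.setICr.
apply: (connect_trans (y := mid)); apply: connect1.
  by rewrite /face_linked /= NM mid_M face_N.
by rewrite /face_linked /= mid_M (dstar_M e_sym e_irr okC) face_star orbT.
Qed.

(** Both stars are faces of the cell whose tree is the edge {w, w'}. *)
Lemma star_linked_star w w' : dominating e w -> dominating e w' ->
  connect (face_linked (M_G e)) (star w) (star w').
Proof.
move=> dom_w dom_w'; have [->|w_w'] := eqVneq w w'; first exact: connect0.
have w'_w : w' != w by rewrite eq_sym.
have ok_left K : K \subset ~: [set w; w'] -> dstar_ok e w w' finset.set0 K.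
  move=> /fintype.subsetP sub; split=> //.
  - by move=> x; rewrite finset.inE.
  - by move=> x /sub; rewrite finset.in_setC.
  - by move=> x x_w _; have /dominatingP := dom_w; apply.
have okC := ok_left _ (fintype.subxx _).
have ok0 := ok_left _ (finset.sub0set _).
pose edge_cell := dstar w w' finset.set0 finset.set0.
have edge_M : edge_cell \in M_G e := dstar_M e_sym e_irr ok0.
have face_w' : face (star w') edge_cell.
  rewrite -(dstar_full w_w'); apply: dstar_face_right; first exact: finset.sub0set.
  by rewrite finset.setU0 disjoint_sym -finset.setI_eq0 finset.setICr.
have face_w : face (star w) edge_cell.
  rewrite -(dstar_full w'_w) dstarC (finset.setUC [set w']).
  apply: dstar_face_left; first exact: finset.sub0set.
  by rewrite finset.setU0 disjoint_sym -finset.setI_eq0 finset.setICr.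
have star_w'_M : star w' \in M_G e by rewrite -(dstar_full w_w'); apply: dstar_M okC.
have star_w_M : star w \in M_G e.
  rewrite -(dstar_full w'_w); apply: dstar_M => //; split=> //.
  - by move=> x; rewrite finset.inE.
  - by move=> x; rewrite finset.in_setC.
  - by move=> x x_w _; have /dominatingP := dom_w'; apply.
apply: (connect_trans (y := edge_cell)); apply: connect1.
  by rewrite /face_linked /= star_w_M edge_M face_w.
by rewrite /face_linked /= star_w'_M edge_M face_w' orbT.
Qed.

Lemma M_G_linked N N' : N \in M_G e -> N' \in M_G e ->
  connect (face_linked (M_G e)) N N'.
Proof.
move=> /linked_star[w [dom_w _ N_w]] /linked_star[w' [dom_w' _ N'_w']].
apply: connect_trans N_w (connect_trans (star_linked_star dom_w dom_w') _).
by rewrite sym_connect_sym //; apply: face_linked_sym.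
Qed.

End Zigzags.

Section Automorphisms.
Local Open Scope set_scope.
Variables (V : finType) (e : rel V).
Hypotheses (e_sym : symmetric e) (e_irr : irreflexive e).
Implicit Types (g : {perm V}) (u w x : V) (L K : {set V}).

Lemma graph_autP g : reflect (forall x y, e (g x) (g y) = e x y) (g \in graph_aut e).
Proof.
rewrite finset.inE; apply: (iffP forallP) => [aut x y|aut x].
  by have /forallP/(_ y)/eqP := aut x.
by apply/forallP => y; rewrite aut.
Qed.

Lemma net_act_dstar g u w L K :
  net_act g (dstar u w L K) = dstar (g u) (g w) (g @: L) (g @: K).
Proof.
have imU (A B : {set V}) : g @: (A :|: B) = g @: A :|: g @: B by apply: imsetU.
have im2 x y : g @: [set x; y] = [set g x; g y] by rewrite imsetU1 imset_set1.
have imA : g @: ([set u; w] :|: (L :|: K)) = [set g u; g w] :|: (g @: L :|: g @: K).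
  by rewrite imU im2 imU.
apply: net_ext; first exact: imA.
  rewrite /= imsetU1 /= im2 imsetU -!imset_comp.
  by congr (_ |: (_ :|: _)); apply: eq_imset => x /=; rewrite im2.
apply/ffunP => b; rewrite !ffunE -imA -{2}(permKV g b) (mem_imset _ _ perm_inj).
by case: ifP => //= _; rewrite im2.
Qed.

Lemma dstar_ok_aut g u w L K : g \in graph_aut e -> dstar_ok e u w L K ->
  dstar_ok e (g u) (g w) (g @: L) (g @: K).
Proof.
move=> /graph_autP aut [u_w okL okK adj_u dom_w].
have mem_g x (A : {set V}) : (g x \in g @: A) = (x \in A) by rewrite (mem_imset _ _ perm_inj).
have mem2 x : (g x \in [set g u; g w]) = (x \in [set u; w]).
  by rewrite !finset.in_set2 !(inj_eq perm_inj).
split; first by rewrite (inj_eq perm_inj).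
- by move=> _ /imsetP[x xL ->]; rewrite mem2 mem_g okL.
- by move=> _ /imsetP[x xK ->]; rewrite mem2 okK.
- move=> x; rewrite -(permKV g x) (inj_eq perm_inj) mem_g aut; exact: adj_u.
- apply/dominatingP => x; rewrite -(permKV g x) (inj_eq perm_inj) aut.
  exact/dominatingP.
Qed.

Lemma M_G_dstar N : N \in M_G e ->
  exists u w L K, N = dstar u w L K /\ dstar_ok e u w L K.
Proof.
move=> /(M_GP e_sym e_irr)[NX [u [w [biN dom_w]]]]; exists u, w.
exact: bicentered_dstar.
Qed.

(** In the description by double stars the inverse image of a cell is explicit. *)
Lemma M_G_aut g : g \in graph_aut e -> [set net_act g N | N in M_G e] = M_G e.
Proof.
move=> aut_g; have aut_gV : g^-1%g \in graph_aut e.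
  have /graph_autP aut := aut_g.
  by apply/graph_autP => x y; rewrite -{2}(permKV g x) -{2}(permKV g y) aut.
apply/setP => N; apply/imsetP/idP => [[N0 N0_M ->]|/M_G_dstar[u [w [L [K [-> ok]]]]]].
  have [u [w [L [K [-> ok]]]]] := M_G_dstar N0_M.
  rewrite net_act_dstar; exact: dstar_M (dstar_ok_aut aut_g ok).
exists (dstar (g^-1%g u) (g^-1%g w) (g^-1%g @: L) (g^-1%g @: K)).
  exact: dstar_M (dstar_ok_aut aut_gV ok).
have imK (A : {set V}) : g @: (g^-1%g @: A) = A.
  rewrite -imset_comp -[RHS]imset_id; apply: eq_imset => x /=; exact: permKV.
by rewrite net_act_dstar !permKV !imK.
Qed.

End Automorphisms.

(** * Components of spaces of cells *)

Section CellSpaces.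
Variables (R : realType) (V : finType) (e : rel V).
Local Open Scope ring_scope.
Local Open Scope classical_set_scope.
Import GRing.Theory Num.Theory Order.TTheory.
Implicit Types (N : net V) (x y : {ptws net V -> R}) (S Y M : {set net V}).

(** The universal property of the topology of pointwise convergence. *)
Lemma continuous_into_ptws (T : topologicalType) (I : eqType) (f : T -> {ptws I -> R}) :
  (forall i, continuous (fun t => f t i)) -> continuous f.
Proof.
move=> cont_f t; apply/cvg_sup => i; move: t.
apply/(@continuousP _ (initial_topology (@^~ i))) => A [B oB <-].
rewrite -[_ @^-1` _]/((fun t => f t i) @^-1` B).
by apply: open_comp => // t _; apply: cont_f.
Qed.

Definition segment x N (t : R) : {ptws net V -> R} :=
  fun N' => (1 - t) * x N' + t * (N' == N)%:R.

Lemma segment_continuous x N : continuous (segment x N).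
Proof.
apply: continuous_into_ptws => N' t.
apply: cvgD; apply: cvgM; try exact: cvg_cst; last exact: cvg_id.
by apply: cvgB; [exact: cvg_cst | exact: cvg_id].
Qed.

Lemma face_refl N : face N N. Proof. exact: connect0. Qed.

Lemma face_trans N1 N2 N3 : face N1 N2 -> face N2 N3 -> face N1 N3.
Proof. by move=> f12 f23; apply: connect_trans f23 f12. Qed.

(** For t > 0 the support of the point gains N', which lies above the whole
    support of x. *)
Lemma segment_open_cell x N N' (t : R) : N' \in X_G e -> open_cell e N x ->
  face N N' -> 0 < t <= 1 -> open_cell e N' (segment x N' t).
Proof.
move=> N'X [[x_ge0 x_sum x_X x_chain] _ x_le_N] face_N /andP[t_gt0 t_le1].
have t1_ge0 : 0 <= 1 - t by rewrite subr_ge0.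
have supp N'' : segment x N' t N'' != 0 -> x N'' != 0 \/ N'' = N'.
  move=> nz; have [|x0] := eqVneq (x N'') 0; last by left.
  have [->|ne] := eqVneq N'' N'; first by right.
  by move=> x0; move: nz; rewrite /segment x0 (negPf ne) !mulr0 addr0 eqxx.
have le_N' N'' : segment x N' t N'' != 0 -> face N'' N'.
  move=> /supp[/x_le_N|->]; last exact: face_refl.
  by move=> f; apply: face_trans face_N.
split=> //.
- split.
  + by move=> N''; rewrite /segment addr_ge0 ?mulr_ge0 // ltW.
  + rewrite /segment big_split /= -!mulr_sumr x_sum (bigD1 N') //= eqxx.
    by rewrite big1 ?addr0 ?mulr1 ?subrK // => N'' /negPf ->.
  + by move=> N'' /supp[/x_X|->].
  + move=> N1 N2 s1 s2; have [x1|->] := supp _ s1; last by rewrite (le_N' _ s2) orbT.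
    by have [x2|->] := supp _ s2; [exact: x_chain | rewrite (le_N' _ s1)].
- rewrite /segment eqxx mulr1 gt_eqF //.
  by apply: ltr_wpDl => //; apply: mulr_ge0.
Qed.

Lemma segment0 x N : segment x N 0 = x.
Proof. by apply/funext => N'; rewrite /segment subr0 mul1r mul0r addr0. Qed.

Definition barycentre N : {ptws net V -> R} := fun N' => (N' == N)%:R.

Lemma segment1 x N : segment x N 1 = barycentre N.
Proof. by apply/funext => N'; rewrite /segment subrr mul0r mul1r add0r. Qed.

Lemma barycentre_open_cell N : N \in X_G e -> open_cell e N (barycentre N).
Proof.
have supp N' : barycentre N N' != 0 -> N' = N.
  by rewrite /barycentre; case: (eqVneq N' N) => // _; rewrite eqxx.
move=> NX; split; [split| |].
- by move=> N'; rewrite /barycentre ler0n.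
- rewrite (bigD1 N) //= /barycentre eqxx big1 ?addr0 // => N' /negPf -> //.
- by move=> N' /supp ->.
- by move=> N1 N2 /supp -> /supp ->; rewrite face_refl.
- by rewrite /barycentre eqxx oner_neq0.
- by move=> N' /supp ->; exact: face_refl.
Qed.

(** The segment from x to the barycentre of N' starts in the open cell of N and
    then stays in that of N'. *)
Lemma component_barycentre S x N N' : N \in S -> N' \in S -> N' \in X_G e ->
  open_cell e N x -> face N N' ->
  connected_component (cells_space e S) x (barycentre N').
Proof.
move=> NS N'S N'X x_N face_N.
apply: (@connected_component_max _ _ (segment x N' @` `[0, 1])).
- by exists 0; [rewrite /= in_itv /= lexx ler01 | exact: segment0].
- move=> _ [t /= t01 <-]; move: t01; rewrite in_itv /= => /andP[t_ge0 t_le1].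
  have [->|t_neq0] := eqVneq t 0; first by rewrite segment0; exists N.
  exists N' => //; apply: (segment_open_cell N'X x_N face_N).
  by rewrite lt0r t_neq0 t_ge0.
- apply: connected_continuous_connected; first exact: segment_connected.
  by apply: continuous_subspaceT; exact: segment_continuous.
- by exists 1; [rewrite /= in_itv /= lexx ler01 | exact: segment1].
Qed.

(** The barycentres of a cell and of one of its faces are joined by a segment, and
    a zigzag of faces gives a chain of such segments. *)
Lemma component_face_linked M N N' : M \subset X_G e -> N \in M ->
  connect (face_linked M) N N' ->
  connected_component (cells_space (R := R) e M) (barycentre N) (barycentre N').
Proof.
move=> /fintype.subsetP MX NM /connectP[p]; elim: p N NM => [|N1 p IHp] N NM /=.
  move=> _ ->; apply: connected_component_refl; exists N => //.
  exact: barycentre_open_cell (MX _ NM).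
case/andP => /and3P[_ N1M face_N1] path_p last_p.
apply: connected_component_trans (IHp _ N1M path_p last_p).
case/orP: face_N1 => face_N1.
  apply: (component_barycentre NM N1M (MX _ N1M)) => //.
  exact: barycentre_open_cell (MX _ NM).
apply: connected_component_sym.
apply: (component_barycentre N1M NM (MX _ NM)) => //.
exact: barycentre_open_cell (MX _ N1M).
Qed.

(** The points having a cell of S in their support: the union of the open stars,
    in the barycentric subdivision, of the vertices indexed by S. *)
Definition open_star S : set {ptws net V -> R} :=
  \bigcup_(N in [set` S]) [set x | x N != 0].

Lemma open_star_open S : open (open_star S).
Proof.
apply: bigcup_open => N _.
rewrite -[X in open X]/((@proj _ (fun=> R) N) @^-1` [set r : R | r != 0]).
apply: open_comp; first by move=> x _; exact: proj_continuous.
exact: open_neq.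
Qed.

(** The largest cell of the supporting chain of a point is above every cell of the
    support, so an upward closed set of cells is cut out by open stars. *)
Lemma cells_space_open_star Y S : S \subset Y ->
  (forall N N', N \in S -> N' \in Y -> face N N' -> N' \in S) ->
  cells_space e S = cells_space e Y `&` open_star S.
Proof.
move=> /fintype.subsetP sub up; apply/seteqP; split=> x.
  case=> N NS [cx xN x_le]; split; last by exists N.
  by exists N; [exact: sub | split].
case=> -[N NY [cx xN x_le]] [N0 /= N0S xN0]; exists N; last by split.
exact: up N0S NY (x_le _ xN0).
Qed.

(** Both M and its complement in Y are closed under cofaces in Y, so both are cut
    out of Y by open sets; a connected set through a point of M cannot leave M. *)
Lemma linked_cells_component Y M : M != finset.set0 -> M \subset Y -> Y \subset X_G e ->
  (forall N N', N \in M -> N' \in Y -> face N N' || face N' N -> N' \in M) ->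
  (forall N N', N \in M -> N' \in M -> connect (face_linked M) N N') ->
  is_connected_component (cells_space (R := R) e Y) (cells_space e M).
Proof.
case/set0Pn => N0 N0M MY YX closedM linkedM.
have /fintype.subsetP M_Y := MY.
have MX : M \subset X_G e := fintype.subset_trans MY YX.
have /fintype.subsetP M_X := MX.
have subMY : cells_space e M `<=` cells_space (R := R) e Y.
  by move=> x [N NM x_N]; exists N => //; exact: M_Y.
have x0_M : cells_space e M (barycentre N0).
  by exists N0 => //; apply: barycentre_open_cell (M_X _ N0M).
exists (barycentre N0); first exact: subMY.
apply/seteqP; split=> [x [N NM x_N]|x [C [C0 CY conn_C] Cx]].
  have linked := component_face_linked MX N0M (linkedM _ _ N0M NM).
  have x_bN := component_barycentre NM NM (M_X _ NM) x_N (face_refl N).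
  have := connected_component_trans linked (connected_component_sym x_bN).
  case=> C [C0 CM conn_C Cx]; exists C => //; split=> //.
  exact: subset_trans CM subMY.
have openM : cells_space e M = cells_space e Y `&` open_star M.
  apply: cells_space_open_star => // N N' NM N'Y face_N.
  by apply: (closedM N) => //; rewrite face_N.
have openD : cells_space e (Y :\: M)%SET = cells_space e Y `&` open_star (Y :\: M)%SET.
  apply: cells_space_open_star; first exact: finset.subsetDl.
  move=> N N'; rewrite !finset.in_setD => /andP[N_M NY] N'Y face_N; rewrite N'Y andbT.
  by apply: contra N_M => N'M; apply: (closedM N') => //; rewrite face_N orbT.
rewrite openM; split; first exact: CY.
suff CM : C `&` open_star M = C by move: Cx; rewrite -CM => -[].
apply: conn_C.
- by exists (barycentre N0); split; move: x0_M; rewrite // openM => -[].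
- by exists (open_star M) => //; exact: open_star_open.
- exists (~` open_star (Y :\: M)%SET); first exact/open_closedC/open_star_open.
  apply/seteqP; split=> y [Cy]; have Yy := CY _ Cy.
    move=> y_M; split=> // y_D.
    have [N NM [_ yN y_le]] : cells_space e M y by rewrite openM.
    have [N' N'D [_ yN' y_le']] : cells_space e (Y :\: M)%SET y by rewrite openD.
    move: N'D; rewrite finset.in_setD => /andP[/negP N'_M N'Y]; apply: N'_M.
    by apply: (closedM N) => //; rewrite (y_le' _ yN).
  move=> not_y_D; split=> //; have [N NY y_N] := Yy.
  have [_ yN _] := y_N.
  have [NM|N_M] := boolP (N \in M); first by exists N.
  by case: not_y_D; exists N => //=; rewrite finset.in_setD N_M.
Qed.

End CellSpaces.

(** * The minimal spine complex *)

Theorem proposition2p23 (R : realType) (V : finType) (e : rel V)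
    (e_sym : symmetric e) (e_irr : irreflexive e)
    (e_conn : forall v w : V, connect e v w)
    (n_ge3 : (3 <= #|V|)%N) :
  (M_G e = finset.set0 \/
   is_connected_component (cells_space (R := R) e (Y_G e))
                          (cells_space (R := R) e (M_G e))) /\
  (forall g : {perm V}, g \in graph_aut e ->
     [set net_act g N | N in M_G e]%SET = M_G e).
Proof.
split; last by move=> g; exact: M_G_aut.
have [M0|M_neq0] := eqVneq (M_G e) finset.set0; [by left | right].
apply: linked_cells_component => //.
- by apply/fintype.subsetP => N; rewrite finset.inE => /andP[].
- by apply/fintype.subsetP => N; rewrite finset.inE => /andP[].
- move=> N N' NM N'Y /orP[face_N|face_N].
    exact: M_G_face_up face_N.
  exact: M_G_face_down face_N.
- by move=> N N'; exact: M_G_linked.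
Qed.
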